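(* Let $C$ be a conjecture in ZFC (seen as a sub-theory of NBG) given by a well-formed formula $\phi$. Then there exists a corresponding dual conjecture $C^+$ in D-ZFC, given by the dual well-formed formula $\phi^+$, such that $C$ is provable in ZFC if and only if $C^+$ is provable in D-ZFC, i.e., $\mathrm{ZFC}\vdash\phi$ if and only if $\text{D-ZFC}\vdash\phi^+$. Moreover, if $P=(P_1,\dots,P_m)$ is a proof of $\phi$ in ZFC, then its dual version $P^+=(P_1^+,\dots,P_m^+)$ is a proof of $\phi^+$ in D-ZFC, and vice versa. In other words, standard mathematics (the theories grounded on ZFC) and dathematics (the dual theories grounded on D-ZFC) are meta-isomorphic. In particular, ZFC and D-ZFC are equiconsistent.
   Context: NBG is von Neumann–Bernays–Gödel set theory (in Mendelson's presentation), a first-order theory of classes with equality and membership $\in$; a class $X$ is a set if $(\exists Y)(X\in Y)$. ZFC is seen as a sub-theory of NBG by letting its variables range over sets. For every class $X$, $X^+$ denotes its complement class, the unique class such that for all sets $a$: $a\in X\leftrightarrow a\notin X^+$. The dual membership relation $\varepsilon$ between classes is defined by $$(\forall A,B)(A\,\varepsilon\,B\leftrightarrow A^+\in B^+).$$ A class $X$ is a sed (dual set) if $(\exists Y)(X\,\varepsilon\,Y)$; equivalently, if its complement $X^+$ is a set. Equality is self-dual: $(\forall Z)(Z\,\varepsilon\,X\leftrightarrow Z\,\varepsilon\,Y)$ holds if and only if $X=Y$. For a formula $\phi$ in the language $\{=,\in\}$ of ZFC (all variables ranging over sets), $\phi^+$ is the formula in the language $\{=,\varepsilon\}$ obtained by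 replacing every occurrence of $\in$ by $\varepsilon$ and every set variable by a sed variable of the same name (a variable ranging over seds). Such a formula is called a dual well-formed formula. D-ZFC is the first-order theory in the language $\{=,\varepsilon\}$, with variables ranging over seds, whose proper axioms are the duals $\psi^+$ of the axioms $\psi$ of ZFC, with the usual logical axioms of first-order logic with equality and the same inference rules as ZFC (Modus Ponens and Generalization). It is regarded as a sub-theory of NBG by interpreting $A\,\varepsilon\,B$ as $A^+\in B^+$ and letting its variables range over the seds, i.e., the classes $X$ whose complement $X^+$ is a set. ''Meta-isomorphic'' means the syntactic correspondence described in the claim: $\phi\mapsto\phi^+$ and $P\mapsto P^+$ match formulas, theorems and proofs of ZFC with those of D-ZFC, in both directions. *)

(* Defs.v *)
From HB Require Import structures.
From mathcomp Require Import all_boot.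
From Stdlib Require List.

Set Implicit Arguments.
Unset Strict Implicit.
Unset Printing Implicit Defensive.

Declare Scope fol_scope.
Delimit Scope fol_scope with fol.

(* Formulas over variables V and binary predicate letters R; as in Mendelson, *)
(* the primitive connectives are negation, implication and universal          *)
(* quantification. There are no function letters, so the terms are exactly    *)
(* the variables.                                                             *)
Inductive form (V R : Type) : Type :=
  | Eq (x y : V)
  | Rel (r : R) (x y : V)
  | Neg (p : form V R)
  | Imp (p q : form V R)
  | All (x : V) (p : form V R).

Arguments Eq {V R} x y.

Bind Scope fol_scope with form.

Definition And {V R} (p q : form V R) := Neg (Imp p (Neg q)).
Definition Or {V R} (p q : form V R) := Imp (Neg p) q.
Definition Iff {V R} (p q : form V R) := And (Imp p q) (Imp q p).
Definition Ex {V R} (x : V) (p : form V R) := Neg (All x (Neg p)).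

Notation "x ≐ y" := (Eq x y) (at level 30, no associativity) : fol_scope.
Notation "¬ p" := (Neg p) (at level 35, right associativity) : fol_scope.
Notation "p ⩑ q" := (And p q) (at level 40, left associativity) : fol_scope.
Notation "p ⩒ q" := (Or p q) (at level 45, left associativity) : fol_scope.
Notation "p ⇒ q" := (Imp p q) (at level 60, right associativity) : fol_scope.
Notation "p ⇔ q" := (Iff p q)
  (at level 55, q at level 60, no associativity) : fol_scope.
Notation "'∀' x , p" := (All x p)
  (at level 60, x at level 0, p at level 60, right associativity) : fol_scope.
Notation "'∃' x , p" := (Ex x p)
  (at level 60, x at level 0, p at level 60, right associativity) : fol_scope.

Section Logic.
Variables (V : eqType) (R : Type).
Local Notation form := (form V R).
Local Open Scope fol_scope.

Fixpoint free (x : V) (p : form) : bool :=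
  match p with
  | Eq u v => (x == u) || (x == v)
  | Rel _ u v => (x == u) || (x == v)
  | Neg q => free x q
  | Imp q r => free x q || free x r
  | All z q => (x != z) && free x q
  end.

(* "y is free for x in p": no free occurrence of x in p lies in the scope of  *)
(* a quantifier binding y.                                                    *)
Fixpoint free_for (y x : V) (p : form) : bool :=
  match p with
  | Eq _ _ | Rel _ _ _ => true
  | Neg q => free_for y x q
  | Imp q r => free_for y x q && free_for y x r
  | All z q => ~~ free x (All z q) || (z != y) && free_for y x q
  end.

Definition vsubst (x y u : V) : V := if u == x then y else u.

(* Capture is not avoided here; substitution is only used under [free_for].   *)
Fixpoint subst (x y : V) (p : form) : form :=
  match p with
  | Eq u v => Eq (vsubst x y u) (vsubst x y v)
  | Rel r u v => Rel r (vsubst x y u) (vsubst x y v)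
  | Neg q => Neg (subst x y q)
  | Imp q r => Imp (subst x y q) (subst x y r)
  | All z q => if z == x then All z q else All z (subst x y q)
  end.

(* [some_subst x y p q]: q arises from p by replacing some, not necessarily   *)
(* all, free occurrences of x by y.                                           *)
Definition some_vsubst (x y u u' : V) : Prop := u' = u \/ (u = x /\ u' = y).

Inductive some_subst (x y : V) : form -> form -> Prop :=
  | some_subst_eq u v u' v' :
      some_vsubst x y u u' -> some_vsubst x y v v' ->
      some_subst x y (Eq u v) (Eq u' v')
  | some_subst_rel r u v u' v' :
      some_vsubst x y u u' -> some_vsubst x y v v' ->
      some_subst x y (Rel r u v) (Rel r u' v')
  | some_subst_neg p p' :
      some_subst x y p p' -> some_subst x y (Neg p) (Neg p')
  | some_subst_imp p p' q q' :
      some_subst x y p p' -> some_subst x y q q' ->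
      some_subst x y (Imp p q) (Imp p' q')
  | some_subst_bound p : some_subst x y (All x p) (All x p)
  | some_subst_all z p p' :
      z != x -> some_subst x y p p' -> some_subst x y (All z p) (All z p').

(* Mendelson's axioms (A1)-(A7) for first-order logic with equality.          *)
Inductive logical_axiom : form -> Prop :=
  | axiom_A1 p q : logical_axiom (p ⇒ (q ⇒ p))
  | axiom_A2 p q r :
      logical_axiom ((p ⇒ (q ⇒ r)) ⇒ ((p ⇒ q) ⇒ (p ⇒ r)))
  | axiom_A3 p q : logical_axiom ((¬ q ⇒ ¬ p) ⇒ ((¬ q ⇒ p) ⇒ q))
  | axiom_A4 x y p : free_for y x p -> logical_axiom ((∀ x, p) ⇒ subst x y p)
  | axiom_A5 x p q :
      ~~ free x p -> logical_axiom ((∀ x, (p ⇒ q)) ⇒ (p ⇒ ∀ x, q))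
  | axiom_A6 x : logical_axiom (∀ x, x ≐ x)
  | axiom_A7 x y p q :
      free_for y x p -> some_subst x y p q ->
      logical_axiom (x ≐ y ⇒ (p ⇒ q)).

(* A theory is given by its set of proper axioms.                             *)
Definition theory := form -> Prop.

Definition axiom (T : theory) (p : form) : Prop := logical_axiom p \/ T p.

Definition modus_ponens (Q : seq form) (p : form) : Prop :=
  exists q, List.In q Q /\ List.In (q ⇒ p) Q.

Definition generalization (Q : seq form) (p : form) : Prop :=
  exists x q, List.In q Q /\ p = (∀ x, q).

Definition is_proof (T : theory) (P : seq form) (p : form) : Prop :=
  (exists Q, P = rcons Q p) /\
  (forall Q q Q', P = Q ++ q :: Q' ->
     [\/ axiom T q, modus_ponens Q q | generalization Q q]).

Definition provable (T : theory) (p : form) : Prop :=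
  exists P, is_proof T P p.

Definition consistent (T : theory) : Prop :=
  ~ exists p, provable T p /\ provable T (¬ p).

End Logic.

(* [d] matches formulas, theorems and proofs of T with those of T', in both   *)
(* directions: as [d] is bijective, so is [map d] on sequences of formulas.   *)
Definition meta_isomorphism (V V' : eqType) (R R' : Type)
    (d : form V R -> form V' R') (T : theory V R) (T' : theory V' R') : Prop :=
  [/\ bijective d,
      forall p, provable T p <-> provable T' (d p)
    & forall P p, is_proof T P p <-> is_proof T' (map d P) (d p)].

(* The language of ZFC (set variables, letter ∈) and that of D-ZFC (sed       *)
(* variables, letter ε) are kept disjoint. Provability in D-ZFC only uses its *)
(* axioms: the reading of A ε B in NBG as A⁺ ∈ B⁺, with variables ranging     *)
(* over the seds, is an interpretation of this theory and not part of it.     *)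
Record set_var := SetVar { set_name : nat }.
HB.instance Definition _ := [isNew for set_name].
HB.instance Definition _ := [Equality of set_var by <:].

Record sed_var := SedVar { sed_name : nat }.
HB.instance Definition _ := [isNew for sed_name].
HB.instance Definition _ := [Equality of sed_var by <:].

Inductive in_letter := In.
Inductive eps_letter := Eps.

Definition set_form := form set_var in_letter.
Definition sed_form := form sed_var eps_letter.

Notation "x ∊ y" := (@Rel set_var in_letter In x y)
  (at level 30, no associativity) : fol_scope.

Definition dual_var (x : set_var) : sed_var := SedVar (set_name x).

Fixpoint dual (p : set_form) : sed_form :=
  match p with
  | Eq x y => Eq (dual_var x) (dual_var y)
  | Rel In x y => Rel Eps (dual_var x) (dual_var y)
  | Neg q => Neg (dual q)
  | Imp q r => Imp (dual q) (dual r)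
  | All x q => All (dual_var x) (dual q)
  end.

Section ZFCAxioms.
Local Open Scope fol_scope.
Local Notation x := (SetVar 0).
Local Notation y := (SetVar 1).
Local Notation z := (SetVar 2).
Local Notation u := (SetVar 3).
Local Notation v := (SetVar 4).

Definition extensionality : set_form :=
  ∀ x, ∀ y, ((∀ z, (z ∊ x ⇔ z ∊ y)) ⇒ x ≐ y).

Definition pairing : set_form :=
  ∀ x, ∀ y, ∃ z, ∀ u, (u ∊ z ⇔ u ≐ x ⩒ u ≐ y).

Definition union : set_form :=
  ∀ x, ∃ y, ∀ u, (u ∊ y ⇔ ∃ v, (u ∊ v ⩑ v ∊ x)).

Definition power_set : set_form :=
  ∀ x, ∃ y, ∀ u, (u ∊ y ⇔ ∀ v, (v ∊ u ⇒ v ∊ x)).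

Definition infinity : set_form :=
  ∃ x, ((∃ y, (y ∊ x ⩑ ∀ z, ¬ (z ∊ y)))
        ⩑ (∀ y, (y ∊ x ⇒ ∃ z, (z ∊ x ⩑ ∀ u, (u ∊ z ⇔ u ∊ y ⩒ u ≐ y))))).

Definition foundation : set_form :=
  ∀ x, ((∃ y, y ∊ x) ⇒ ∃ y, (y ∊ x ⩑ ∀ z, (z ∊ x ⇒ ¬ (z ∊ y)))).

(* Every set of nonempty, pairwise disjoint sets has a transversal.           *)
Definition choice : set_form :=
  ∀ x, ((∀ y, (y ∊ x ⇒ ∃ z, z ∊ y))
        ⩑ (∀ y, ∀ z, (y ∊ x ⩑ z ∊ x ⩑ (∃ u, (u ∊ y ⩑ u ∊ z)) ⇒ y ≐ z))
        ⇒ ∃ v, ∀ y, (y ∊ x ⇒ ∃ z, ∀ u, (u ∊ y ⩑ u ∊ v ⇔ u ≐ z))).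

End ZFCAxioms.

Definition separation (x a b : set_var) (p : set_form) : set_form :=
  (∀ a, ∃ b, ∀ x, (x ∊ b ⇔ x ∊ a ⩑ p))%fol.

(* The premise says that, for each x in a, at most one y satisfies p.         *)
Definition replacement (x y z a b : set_var) (p : set_form) : set_form :=
  (∀ a, ((∀ x, (x ∊ a ⇒ ∃ z, ∀ y, (p ⇒ y ≐ z)))
         ⇒ ∃ b, ∀ y, (y ∊ b ⇔ ∃ x, (x ∊ a ⩑ p))))%fol.

(* In the two schemes p may contain further free variables (parameters).      *)
Inductive ZFC : theory set_var in_letter :=
  | ZFC_extensionality : ZFC extensionality
  | ZFC_pairing : ZFC pairing
  | ZFC_union : ZFC union
  | ZFC_power_set : ZFC power_set
  | ZFC_infinity : ZFC infinity
  | ZFC_foundation : ZFC foundation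
  | ZFC_choice : ZFC choice
  | ZFC_separation x a b p :
      uniq [:: x; a; b] -> ~~ free b p -> ZFC (separation x a b p)
  | ZFC_replacement x y z a b p :
      uniq [:: x; y; z; a; b] -> ~~ free z p -> ~~ free b p ->
      ZFC (replacement x y z a b p).

Definition DZFC : theory sed_var eps_letter :=
  fun q => exists2 p, ZFC p & q = dual p.

(* Main.v *)
Require Import Defs.
From mathcomp Require Import all_boot.
From Stdlib Require List.

Set Implicit Arguments.
Unset Strict Implicit.
Unset Printing Implicit Defensive.

(** Every logical axiom scheme and every rule of inference is stated up to the
    names of the variables and of the predicate letters, so an injective
    renaming of variables, together with any renaming of letters, carries a
    proof step to a proof step. Duality is such a renaming; it is invertible,
    its inverse is again a renaming, and by definition it matches the proper
    axioms of ZFC with those of D-ZFC. *)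

Fixpoint rename (V V' R R' : Type) (f : V -> V') (h : R -> R')
    (p : form V R) : form V' R' :=
  match p with
  | Eq x y => Eq (f x) (f y)
  | Rel r x y => Rel (h r) (f x) (f y)
  | Neg q => Neg (rename f h q)
  | Imp q r => Imp (rename f h q) (rename f h r)
  | All x q => All (f x) (rename f h q)
  end.

Lemma renameK (V V' R R' : Type) (f : V -> V') (f' : V' -> V)
    (h : R -> R') (h' : R' -> R) :
  cancel f f' -> cancel h h' -> cancel (rename f h) (rename f' h').
Proof.
move=> fK hK; elim=> /= [x y|r x y|p ->|p -> q ->|x p ->] //;
by rewrite ?hK !fK.
Qed.

Section Rename.
Variables (V V' : eqType) (R R' : Type) (f : V -> V') (h : R -> R').
Hypothesis f_inj : injective f.
Local Notation ren := (rename f h).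

(** Injectivity keeps distinct variables distinct, so renaming neither captures a free occurrence
    nor creates one. *)
Lemma free_rename x p : free (f x) (ren p) = free x p.
Proof.
by elim: p => /= [u v|r u v|p ->|p -> q ->|z p ->]; rewrite ?inj_eq.
Qed.

Lemma free_for_rename x y p : free_for (f y) (f x) (ren p) = free_for y x p.
Proof.
elim: p => //= [p -> q -> //|z p ->].
by rewrite !inj_eq // free_rename.
Qed.

Lemma vsubst_rename x y u : vsubst (f x) (f y) (f u) = f (vsubst x y u).
Proof. by rewrite /vsubst inj_eq //; case: ifP. Qed.

Lemma subst_rename x y p : subst (f x) (f y) (ren p) = ren (subst x y p).
Proof.
elim: p => /= [u v|r u v|p ->|p -> q ->|z p IHp] //; rewrite ?vsubst_rename //.
by rewrite inj_eq // IHp; case: ifP.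
Qed.

Lemma some_vsubst_rename x y u u' :
  some_vsubst x y u u' -> some_vsubst (f x) (f y) (f u) (f u').
Proof. by case=> [->|[-> ->]]; [left | right]. Qed.

Lemma some_subst_rename x y p q :
  some_subst x y p q -> some_subst (f x) (f y) (ren p) (ren q).
Proof.
elim=> {p q} /=; try by move=> *; constructor; try exact: some_vsubst_rename.
by move=> z p p' zx _ IHp; apply: some_subst_all; rewrite ?inj_eq.
Qed.

(** (A1)-(A3) and (A6) are preserved by their mere shape; (A4), (A5) and (A7) carry side conditions
    on variables, which is where injectivity of [f] enters. *)
Lemma logical_axiom_rename p : logical_axiom p -> logical_axiom (ren p).
Proof.
case=> {p} /=; try by move=> *; constructor.
- by move=> x y p yxp; rewrite -subst_rename; apply: axiom_A4;
    rewrite free_for_rename.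
- by move=> x p q xp; apply: axiom_A5; rewrite free_rename.
- move=> x y p q yxp pq; apply: axiom_A7; first by rewrite free_for_rename.
  exact: some_subst_rename.
Qed.

Lemma is_proof_rename (T : theory V R) (T' : theory V' R') P p :
  (forall q, T q -> T' (ren q)) ->
  is_proof T P p -> is_proof T' (map ren P) (ren p).
Proof.
move=> TT' [[Q ->] steps]; split; first by exists (map ren Q); rewrite map_rcons.
(* A splitting of the renamed list comes from a splitting of [P] at the same place; the second piece
   is nonempty because its image starts with [q']. So the justification of [q] in [P] can be
   transported. *)
move=> S' q' U' /List.map_eq_app [S [[|q U] [defP [<- //]]]] [<- _].
have [[logq|Tq]|[r [Sr Srq]]|[x [r [Sr ->]]]] := steps S q U defP.
- by apply: Or31; left; apply: logical_axiom_rename.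
- by apply: Or31; right; apply: TT'.
- apply: Or32; exists (ren r); split; first exact: List.in_map.
  exact: (List.in_map ren _ _ Srq).
- apply: Or33; exists (f x), (ren r); split=> //; exact: List.in_map.
Qed.

End Rename.

Definition undual_var (x : sed_var) : set_var := SetVar (sed_name x).

Definition undual : sed_form -> set_form := rename undual_var (fun=> In).

Lemma dual_varK : cancel dual_var undual_var. Proof. by case. Qed.

Lemma undual_varK : cancel undual_var dual_var. Proof. by case. Qed.

(** [dual] matches on the letter where [rename] applies a function; they agree since [In] is the
    only letter. *)
Lemma dualE : dual =1 rename dual_var (fun=> Eps).
Proof. by elim=> /= [||p ->|p -> q ->|x p ->] // []. Qed.

Lemma dualK : cancel dual undual.
Proof. by move=> p; rewrite dualE; apply: renameK dual_varK _ p; case. Qed.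

Lemma undualK : cancel undual dual.
Proof. by move=> p; rewrite dualE; apply: renameK undual_varK _ p; case. Qed.

Lemma is_proof_dual P p :
  is_proof ZFC P p -> is_proof DZFC (map dual P) (dual p).
Proof.
rewrite (eq_map dualE) dualE; apply: is_proof_rename.
  exact: can_inj dual_varK.
by move=> q ZFCq; exists q; rewrite ?dualE.
Qed.

(** A proper axiom of D-ZFC is by definition some [dual p] with [p] an axiom of ZFC, and [undual]
    recovers this [p]. *)
Lemma is_proof_undual Q q :
  is_proof DZFC Q q -> is_proof ZFC (map undual Q) (undual q).
Proof.
apply: is_proof_rename; first exact: can_inj undual_varK.
by move=> _ [p ZFCp ->]; rewrite -/undual dualK.
Qed.

Lemma is_proof_dualE P p :
  is_proof ZFC P p <-> is_proof DZFC (map dual P) (dual p).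
Proof.
split=> [|/is_proof_undual]; first exact: is_proof_dual.
by rewrite (mapK dualK) dualK.
Qed.

Lemma provable_dualE p : provable ZFC p <-> provable DZFC (dual p).
Proof.
split=> [[P /is_proof_dual]|[Q /is_proof_undual]]; first by exists (map dual P).
by rewrite dualK; exists (map undual Q).
Qed.

Lemma consistent_dualE : consistent ZFC <-> consistent DZFC.
Proof.
split=> con [p [prp prNp]]; apply: con.
  (* [dual] commutes with negation by computation, so a contradictory pair pulls back to a
     contradictory pair. *)
  by exists (undual p); rewrite !provable_dualE /= undualK.
by exists (dual p); split; move: prp prNp => /provable_dualE ? /provable_dualE ?.
Qed.

Theorem theorem3p1 :
  (forall phi : set_form,
     (provable ZFC phi <-> provable DZFC (dual phi)) /\
     (forall P : seq set_form,
        is_proof ZFC P phi -> is_proof DZFC (map dual P) (dual phi)) /\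
     (forall P : seq set_form,
        is_proof DZFC (map dual P) (dual phi) -> is_proof ZFC P phi) /\
     (forall Q : seq sed_form,
        is_proof DZFC Q (dual phi) ->
        exists P : seq set_form, is_proof ZFC P phi /\ Q = map dual P)) /\
  meta_isomorphism dual ZFC DZFC /\
  (consistent ZFC <-> consistent DZFC).
Proof.
split; last split.
- move=> phi; split; first exact: provable_dualE.
  split; first by move=> P; apply: is_proof_dual.
  split=> [P /is_proof_dualE //|Q /is_proof_undual].
  (* An arbitrary D-ZFC proof [Q] is the dual of its own undual, since every formula in it is a
     dual. *)
  by rewrite dualK; exists (map undual Q); rewrite (mapK undualK).
- split; [by exists undual; [exact: dualK | exact: undualK] | |].
  + exact: provable_dualE.
  + exact: is_proof_dualE.
- exact: consistent_dualE.
Qed.
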